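(* Let $G$ be a group. Then the power graph $\mathrm{Pow}(G)$ and the commuting graph $\mathrm{Com}(G)$ are equal if and only if $G$ has no subgroup isomorphic to any of $\mathbb{Z}$, $\mathbb{Z}\times\mathbb{Z}$, $\mathbb{Z}\times C_p$, or $C_p\times C_q$, where $p,q$ are any primes, not necessarily distinct.
   Context: All graphs are undirected and simple. $G$ is an arbitrary (finite or infinite) group. $\mathrm{Pow}(G)$ is the graph with vertex set $G$ in which two distinct vertices $x,y$ are adjacent if one is an (integer) power of the other. $\mathrm{Com}(G)$ is the graph with vertex set $G$ in which two distinct vertices $x,y$ are adjacent if $xy=yx$. Equality of two graphs on the vertex set $G$ means that they have the same edge set. $C_n$ denotes the cyclic group of order $n$. *)

(* Defs.v *)
From HB Require Import structures.
From mathcomp Require Import all_boot ssralg ssrint zmodp.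

Set Implicit Arguments.
Unset Strict Implicit.
Unset Printing Implicit Defensive.

Local Open Scope group_scope.

(* A simple graph on a possibly infinite vertex set, hence with adjacency in
   Prop. *)
Record sgraph (V : Type) := SGraph {
  adj : V -> V -> Prop;
  adj_sym : forall x y, adj x y -> adj y x;
  adj_irrefl : forall x, ~ adj x x
}.

(* Leibniz equality of sgraphs would also compare the proofs they carry. *)
Definition same_edges (V : Type) (g h : sgraph V) : Prop :=
  forall x y, adj g x y <-> adj h x y.

(* Negz n stands for - (n + 1). *)
Definition zexpg (G : groupType) (x : G) (m : int) : G :=
  match m with
  | Posz n => x ^+ n
  | Negz n => x ^- n.+1
  end.

Definition is_power_of (G : groupType) (x y : G) : Prop :=
  exists m : int, x = zexpg y m.

Definition pow_adj (G : groupType) (x y : G) : Prop :=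
  x <> y /\ (is_power_of x y \/ is_power_of y x).

Definition com_adj (G : groupType) (x y : G) : Prop :=
  x <> y /\ x * y = y * x.

Lemma pow_adj_sym (G : groupType) (x y : G) : pow_adj x y -> pow_adj y x.
Proof. by case=> nxy [pxy | pyx]; split; auto. Qed.

Lemma pow_adj_irrefl (G : groupType) (x : G) : ~ pow_adj x x.
Proof. by case. Qed.

Lemma com_adj_sym (G : groupType) (x y : G) : com_adj x y -> com_adj y x.
Proof. by case=> nxy cxy; split; auto. Qed.

Lemma com_adj_irrefl (G : groupType) (x : G) : ~ com_adj x x.
Proof. by case. Qed.

Definition power_graph (G : groupType) : sgraph G :=
  SGraph (@pow_adj_sym G) (@pow_adj_irrefl G).

Definition commuting_graph (G : groupType) : sgraph G :=
  SGraph (@com_adj_sym G) (@com_adj_irrefl G).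

Definition group_isomorphic (A B : groupType) : Prop :=
  exists f : {multiplicative A -> B}, bijective f.

(* S is a boolean predicate; classically every subset of G is of this form. *)
Definition has_subgroup_isomorphic_to (G A : groupType) : Prop :=
  exists (S : pred G) (H : subGroupType S), group_isomorphic H A.

(* The groups are written multiplicatively; to_multiplicative turns the
   additive group of a zmodType into one. *)
Definition infinite_cyclic : groupType := Algebra.to_multiplicative int.

(* 'Z_n has n elements only for n > 1. *)
Definition cyclic_of_order (n : nat) : groupType := Algebra.to_multiplicative 'Z_n.

(* Main.v *)
(* Commuting elements with neither a power of the other exist in each listed
   group: 2 and 3 in Z, and the two generators in C_p x C_q.  Conversely,
   excluding Z makes every element torsion.  If u, v commute, u <> 1 and
   u ^ p = v ^ q = 1 for primes p, q, then v is a power of u, since otherwise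
   <u, v> is C_p x C_q.  Hence two nontrivial commuting elements x, y have orders
   p ^ a and p ^ b for the same p, say a <= b, and x is a power of y by induction
   on a: x ^ p = y ^ k with p dividing k, so z = x y ^ (- k / p) satisfies
   z ^ p = 1 and is a power of y ^ (p ^ (b - 1)). *)

Require Import Defs.
From HB Require Import structures.
From mathcomp Require Import all_boot ssralg ssrint zmodp.
From mathcomp Require Import zify boolp.

Set Implicit Arguments.
Unset Strict Implicit.
Unset Printing Implicit Defensive.

Local Open Scope group_scope.

(* Transporting the multiplication of A along f, A itself serves as the
   subgroup, with f as its inclusion into G. *)
Lemma has_subgroup_isomorphic_toP (G A : groupType) :
  has_subgroup_isomorphic_to G A <->
  exists2 f : A -> G, {morph f : a b / a * b} & injective f.
Proof.
split=> [[S [H [g [h gK hK]]]] | [f fM f_inj]].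
  exists (fun a => \val (h a)) => [a b | a b /val_inj eq_h].
    by rewrite (can2_gmulfM gK hK) valM.
  exact: (can_inj hK).
pose S : pred G := fun x => `[< exists a, f a = x >].
(* Choice picks a preimage, and injectivity of [f] makes it unique; this is the section that the
   subtype structure requires. *)
pose pre x (Sx : S x) : A := projT1 (cid (asboolW Sx)).
have preK x (Sx : S x) : f (pre x Sx) = x by rewrite /pre; case: cid.
have pre_rect K (Kpre : forall x Sx, K (pre x Sx)) a : K a.
  have Sfa : S (f a) by apply/asboolP; exists a.
  by rewrite -[a](f_inj _ _ (preK _ Sfa)).
have f1 : f 1 = 1 by apply: (mulgI (f 1)); rewrite -fM !mulg1.
pose subT := isSub.Build G S A pre_rect preK.
pose T : subType S := HB.pack_for (subType S) (A : Type) subT.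
pose subM := isSubMagma.Build G S T fM.
pose M : subMagmaType S := HB.pack_for (subMagmaType S) (A : Type) A subT subM.
pose subU := isSubBaseUMagma.Build G S M f1.
pose H : subGroupType S :=
  HB.pack_for (subGroupType S) (A : Type) A subT subM subU.
exists S, H; exists idfun; by exists idfun.
Qed.

(** * Powers, and embeddings of C_p x C_q and Z *)

(** Differences of naturals cover all integers, so this form lets [zexpgD] add exponents without
    combining signs. *)
Lemma zexpg_subz (G : groupType) (x : G) (a b : nat) :
  zexpg x (Posz a - Posz b)%R = x ^+ a / x ^+ b.
Proof.
case: (leqP b a) => [le_ba | lt_ab]; first by rewrite subzn //= expgnFr.
rewrite -GRing.opprB subzn ?(ltnW lt_ab) //.
rewrite -[(b - a)%N]prednK ?subn_gt0 // -NegzE /= prednK ?subn_gt0 //.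
by rewrite expgnFr ?(ltnW lt_ab) // invgF.
Qed.

Lemma zexpgD (G : groupType) (x : G) (m n : int) :
  zexpg x (m + n)%R = zexpg x m * zexpg x n.
Proof.
have diff (k : int) : exists a b : nat, k = (Posz a - Posz b)%R.
  case: k => a; first by exists a, 0; rewrite GRing.subr0.
  by exists 0, a.+1; rewrite NegzE GRing.sub0r.
have [[a [b ->]] [c [d ->]]] := (diff m, diff n).
rewrite GRing.addrACA -GRing.opprD -!PoszD !zexpg_subz [(b + d)%N]addnC.
rewrite !expgnDr invgM !mulgA; congr (_ * _); rewrite -!mulgA; congr (_ * _).
exact/commuteV/commuteX2.
Qed.

Lemma expg_mod_id (G : groupType) (x : G) (n m : nat) :
  x ^+ n = 1 -> x ^+ (m %% n) = x ^+ m.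
Proof.
by move=> xn; rewrite [in RHS](divn_eq m n) mulnC expgnDr expgnA xn expg1n mul1g.
Qed.

(** Bezout gives a * m = b * n + 1, and [x] raised to b * n is trivial. *)
Lemma expg_coprime (G : groupType) (x : G) (m n : nat) :
  0 < m -> coprime m n -> x ^+ n = 1 -> exists k, x = x ^+ m ^+ k.
Proof.
move=> m_gt0 /(coprimeP n m_gt0)[[a b] /= def1] xn; exists a.
have lt_ba : b * n <= a * m by rewrite ltnW // -subn_gt0 def1.
rewrite -expgnA [(m * a)%N]mulnC -(subnK lt_ba) def1 expgnDr expg1.
by rewrite [(b * n)%N]mulnC expgnA xn expg1n mulg1.
Qed.

(* The element u ^+ i * v ^+ j can only be trivial for j = 0 mod q, since
   otherwise v would be a power of u. *)
Lemma has_CpCq (G : groupType) (u v : G) (p q : nat) :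
    prime p -> prime q -> commute u v -> u <> 1 ->
    u ^+ p = 1 -> v ^+ q = 1 -> ~ (exists k, v = u ^+ k) ->
  has_subgroup_isomorphic_to G (cyclic_of_order p * cyclic_of_order q)%type.
Proof.
move=> p_pr q_pr cuv u_n1 up vq v_nu; apply/has_subgroup_isomorphic_toP.
pose f (a : cyclic_of_order p * cyclic_of_order q) : G :=
  u ^+ (a.1 : 'Z_p) * v ^+ (a.2 : 'Z_q).
have fM : {morph f : a b / a * b}.
  case=> [a1 a2] [b1 b2]; rewrite /f /=.
  (* Exponents in ['Z_p] add modulo [(Zp_trunc p).+2], which is [p] because [p > 1]. *)
  have up' : u ^+ (Zp_trunc p).+2 = 1 by rewrite Zp_cast ?prime_gt1.
  have vq' : v ^+ (Zp_trunc q).+2 = 1 by rewrite Zp_cast ?prime_gt1.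
  rewrite !expg_mod_id // !expgnDr !mulgA.
  congr (_ * _); rewrite -!mulgA; congr (_ * _).
  exact: commuteX2.
have coprime_Zp n (i : 'Z_n) : prime n -> i <> 0%R -> 0 < i /\ coprime i n.
  move=> n_pr /eqP; rewrite -val_eqE /= -lt0n => i_gt0; split=> //.
  rewrite coprime_sym prime_coprime // gtnNdvd //.
  by rewrite -[ltnRHS]Zp_cast ?prime_gt1.
have trivial_ker a : f a = 1 -> a = 1.
  case: a => i j; rewrite /f /= => uv1.
  have j0 : j = 0%R.
    have [//|/eqP/(coprime_Zp _ _ q_pr)[j_gt0 cop_jq]] := eqVneq j 0%R.
    case: v_nu; have [k ->] := expg_coprime j_gt0 cop_jq vq.
    (* Here [v ^+ j] is the inverse of [u ^+ i], which is [u ^+ (i * p.-1)] since [u ^+ p = 1]. *)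
    exists (i * p.-1 * k)%N; rewrite expgnA; congr (_ ^+ k).
    rewrite -(mulg1_eq uv1); apply/mulg1_eq.
    rewrite -expgnDr -mulnS prednK ?prime_gt0 //.
    by rewrite mulnC expgnA up expg1n.
  move: uv1; rewrite j0 mulg1 => ui.
  have [-> //|/eqP/(coprime_Zp _ _ p_pr)[i_gt0 cop_ip]] := eqVneq i 0%R.
  have [k def_u] := expg_coprime i_gt0 cop_ip up.
  by case: u_n1; rewrite def_u ui expg1n.
exists f => // a b eq_f; apply/divg1_eq/trivial_ker; apply: (mulIg (f b)).
by rewrite -fM mulgVK eq_f mul1g.
Qed.

Lemma has_infinite_cyclic (G : groupType) (x : G) :
    (forall n, 0 < n -> x ^+ n <> 1) ->
  has_subgroup_isomorphic_to G infinite_cyclic.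
Proof.
move=> x_inf; apply/has_subgroup_isomorphic_toP.
exists (zexpg x : infinite_cyclic -> G); first exact: zexpgD.
move=> m n eq_mn; apply/eqP; rewrite -GRing.subr_eq0; apply/eqP.
have: zexpg x (m - n)%R = 1.
  by apply: (mulIg (zexpg x n)); rewrite -zexpgD GRing.subrK mul1g.
case: (m - n)%R => -[|k] //=; first by move/x_inf; case.
  by move/eqP; rewrite invg_eq1 => /eqP/x_inf; case.
by move/eqP; rewrite invg_eq1 => /eqP/x_inf; case.
Qed.

(** The least positive exponent killing [x] divides every other one, as the remainder kills [x]
    too. *)
Lemma torsion_order (G : groupType) (x : G) :
    (exists2 n, 0 < n & x ^+ n = 1) ->
  exists2 n, 0 < n & forall m, (x ^+ m == 1) = (n %| m).
Proof.
case=> n0 n0_gt0 /eqP xn0.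
have ex_n : exists n, (0 < n) && (x ^+ n == 1) by exists n0; rewrite n0_gt0.
case: (ex_minnP ex_n) => n /andP[n_gt0 /eqP xn] min_n; exists n => // m.
apply/eqP/idP => [xm | /dvdnP[k ->]]; last by rewrite mulnC expgnA xn expg1n.
rewrite /dvdn -leqn0 leqNgt; apply/negP => r_gt0.
have := min_n (m %% n); rewrite r_gt0 expg_mod_id // xm eqxx => /(_ isT).
by rewrite leqNgt ltn_mod n_gt0.
Qed.

(** * Commuting elements of finite order *)

Section CommutingTorsion.

Variable G : groupType.

(** By [has_CpCq] this holds once no C_p x C_q embeds in [G]. For distinct [p] and [q] it forces
    [v = 1]. *)
Hypothesis unique_prime_subgroup : forall (u v : G) (p q : nat),
  prime p -> prime q -> commute u v -> u <> 1 -> u ^+ p = 1 -> v ^+ q = 1 ->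
  exists k, v = u ^+ k.

(** The powers [x ^+ (n %/ p)] and [y ^+ (m %/ q)] have orders [p] and [q]. The second is a power of
    the first, so [p] also kills it; coprime [p] and [q] would make it trivial. *)
Lemma prime_order_eq (x y : G) (n m p q : nat) :
    (forall k, (x ^+ k == 1) = (n %| k)) ->
    (forall k, (y ^+ k == 1) = (m %| k)) ->
    0 < n -> 0 < m -> commute x y ->
    prime p -> prime q -> p %| n -> q %| m ->
  p = q.
Proof.
move=> ord_x ord_y n_gt0 m_gt0 cxy p_pr q_pr p_n q_m.
have div_n1 (z : G) k r : (forall i, (z ^+ i == 1) = (k %| i)) ->
    0 < k -> prime r -> r %| k -> z ^+ (k %/ r) <> 1 /\ z ^+ (k %/ r) ^+ r = 1.
  move=> ord_z k_gt0 r_pr r_k; split.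
    move/eqP; rewrite ord_z => /dvdn_leq.
    rewrite divn_gt0 ?prime_gt0 // dvdn_leq // => /(_ isT).
    by rewrite leqNgt ltn_Pdiv ?prime_gt1.
  by apply/eqP; rewrite -expgnA divnK // ord_z.
have [u_n1 up] := div_n1 _ _ _ ord_x n_gt0 p_pr p_n.
have [v_n1 vq] := div_n1 _ _ _ ord_y m_gt0 q_pr q_m.
have cuv : commute (x ^+ (n %/ p)) (y ^+ (m %/ q)) by apply: commuteX2.
have [k def_v] := unique_prime_subgroup p_pr q_pr cuv u_n1 up vq.
apply/eqP; apply: contraT => neq_pq.
have cop : coprime p q by rewrite prime_coprime // dvdn_prime2.
have vp : y ^+ (m %/ q) ^+ p = 1.
  by rewrite def_v -expgnA mulnC expgnA up expg1n.
have [l def_v'] := expg_coprime (prime_gt0 p_pr) cop vq.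
by case: v_n1; rewrite def_v' vp expg1n.
Qed.

Lemma power_of_prime_power_order (p b a : nat) (x y : G) :
    prime p -> (forall k, (y ^+ k == 1) = (p ^ b %| k)) ->
    commute x y -> a <= b -> x ^+ (p ^ a) = 1 ->
  exists k, x = y ^+ k.
Proof.
move=> p_pr ord_y; elim: a x => [|a IHa] x cxy lt_ab xpa; first by exists 0.
have [k def_xp] : exists k, x ^+ p = y ^+ k.
  apply: IHa (ltnW lt_ab) _; first exact/commute_sym/commuteX/commute_sym.
  by rewrite -expgnA -expnS.
(* Raising to the power [p ^ a] shows that [p ^ b] divides [k * p ^ a], and [a < b] leaves a factor
   [p] in [k]. *)
have /dvdnP[l def_k] : p %| k.
  have: y ^+ (k * p ^ a) == 1 by rewrite expgnA -def_xp -expgnA -expnS xpa.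
  rewrite ord_y -(subnK lt_ab) addnS -addSn expnD.
  rewrite dvdn_pmul2r ?expn_gt0 ?prime_gt0 //.
  by apply: dvdn_trans; rewrite expnS dvdn_mulr.
have b_gt0 : 0 < b by apply: leq_ltn_trans lt_ab.
(* [w] generates the subgroup of order [p] of the cyclic group of [y]. *)
pose w := y ^+ (p ^ b.-1).
have w_n1 : w <> 1.
  move/eqP; rewrite ord_y dvdn_Pexp2l ?prime_gt1 //.
  by rewrite -[b in X in X -> _]prednK // ltnn.
have wp : w ^+ p = 1.
  by apply/eqP; rewrite -expgnA -expnSr prednK // ord_y.
have cxyl : commute x (y ^+ l) by apply: commuteX.
have zp : (x / y ^+ l) ^+ p = 1.
  by rewrite expgnFl // def_xp def_k expgnA mulgV.
have cwz : commute w (x / y ^+ l).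
  apply: commuteM; last exact/commuteV/commuteX2.
  exact/commute_sym/commuteX.
have [j def_z] := unique_prime_subgroup p_pr p_pr cwz w_n1 wp zp.
by exists (p ^ b.-1 * j + l)%N; rewrite expgnDr expgnA -/w -def_z mulgVK.
Qed.

Lemma commuting_torsion_power (x y : G) :
    commute x y -> (exists2 n, 0 < n & x ^+ n = 1) ->
    (exists2 n, 0 < n & y ^+ n = 1) ->
  (exists k, x = y ^+ k) \/ (exists k, y = x ^+ k).
Proof.
move=> cxy /torsion_order[n n_gt0 ord_x] /torsion_order[m m_gt0 ord_y].
(* Order 1 is set aside, since [pdiv 1] is not prime. *)
have [n1|n_n1] := eqVneq n 1%N.
  by left; exists 0; apply/eqP; rewrite -[x]expg1 ord_x n1.
have [m1|m_n1] := eqVneq m 1%N.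
  by right; exists 0; apply/eqP; rewrite -[y]expg1 ord_y m1.
have same p q := prime_order_eq (p := p) (q := q) ord_x ord_y n_gt0 m_gt0 cxy.
have n_gt1 : 1 < n by rewrite ltn_neqAle eq_sym n_n1.
have m_gt1 : 1 < m by rewrite ltn_neqAle eq_sym m_n1.
pose p := pdiv n; have p_pr : prime p by apply: pdiv_prime.
have m_p : p.-nat m.
  apply/(pnatP _ m_gt0) => q q_pr q_m; rewrite inE /=; apply/eqP/esym.
  exact: same (pdiv_dvd _) q_m.
have n_p : p.-nat n.
  apply/(pnatP _ n_gt0) => q q_pr q_n; rewrite inE /=; apply/eqP.
  (* [same] only compares a prime of [n] with a prime of [m], so two primes of [n] are compared
     through [pdiv m]. *)
  rewrite (same _ _ q_pr (pdiv_prime m_gt1) q_n (pdiv_dvd _)).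
  exact/esym/(same _ _ p_pr (pdiv_prime m_gt1) (pdiv_dvd _) (pdiv_dvd _)).
have [[a def_n] [b def_m]] := (p_natP n_p, p_natP m_p).
have xn : x ^+ (p ^ a) = 1 by apply/eqP; rewrite -def_n ord_x.
have ym : y ^+ (p ^ b) = 1 by apply/eqP; rewrite -def_m ord_y.
rewrite def_n in ord_x; rewrite def_m in ord_y.
case/orP: (leq_total a b) => le_ab; [left | right].
  exact: power_of_prime_power_order p_pr ord_y cxy le_ab xn.
exact: power_of_prime_power_order p_pr ord_x (commute_sym cxy) le_ab ym.
Qed.

End CommutingTorsion.

(** * Passing equality of the graphs to embedded groups *)

Lemma zexpg_morph (A B : groupType) (f : A -> B) (a : A) (m : int) :
  {morph f : x y / x * y} -> f (zexpg a m) = zexpg (f a) m.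
Proof.
move=> fM.
have f1 : f 1 = 1 by apply: (mulgI (f 1)); rewrite -fM !mulg1.
have fX n : f (a ^+ n) = f a ^+ n.
  by elim: n => // n IHn; rewrite !expgS fM IHn.
case: m => n /=; first exact: fX.
by apply/esym/mulg1_eq; rewrite -fX -fM mulgV.
Qed.

(** The group law here is integer addition, so powers are multiples. *)
Lemma zexpg_infinite_cyclic (a : infinite_cyclic) (m : int) :
  zexpg a m = ((a : int) * m)%R.
Proof.
have aX n : a ^+ n = ((a : int) * Posz n)%R.
  elim: n => [|n IHn]; first by rewrite GRing.mulr0.
  by rewrite expgS IHn intS GRing.mulrDr GRing.mulr1.
by case: m => n /=; rewrite aX // NegzE GRing.mulrN.
Qed.

Lemma zexpg1n (A : groupType) (m : int) : zexpg (1 : A) m = 1.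
Proof. by case: m => n /=; rewrite expg1n ?invg1. Qed.

Lemma commute_zexpg (A : groupType) (a : A) (m : int) :
  commute a (zexpg a m).
Proof. by case: m => n; [|apply: commuteV]; apply: commuteX. Qed.

(** An embedding preserves commutation, and injectivity pulls power relations back, so a bad pair in
    [A] refutes equality for [G]. *)
Lemma commuting_subgroup_power (G A : groupType) :
    same_edges (power_graph G) (commuting_graph G) ->
    has_subgroup_isomorphic_to G A ->
  forall a b : A, commute a b -> is_power_of a b \/ is_power_of b a.
Proof.
move=> eq_edges /has_subgroup_isomorphic_toP[f fM f_inj] a b cab.
have [->|/eqP neq_ab] := eqVneq a b; first by left; exists (Posz 1).
have [_ []] : pow_adj (f a) (f b).
- by apply/eq_edges; split; [move/f_inj | rewrite -!fM cab].
- by case=> m; rewrite -zexpg_morph // => /f_inj ->; left; exists m.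
by case=> m; rewrite -zexpg_morph // => /f_inj ->; right; exists m.
Qed.

(** Reduces the exclusion of Z x Z and Z x C_p to that of Z. *)
Lemma has_subgroup_isomorphic_to_fst (G A B : groupType) :
  has_subgroup_isomorphic_to G (A * B)%type -> has_subgroup_isomorphic_to G A.
Proof.
case/has_subgroup_isomorphic_toP => f fM f_inj.
apply/has_subgroup_isomorphic_toP; exists (fun a => f (a, 1)) => [a b | a b].
  by rewrite -fM; congr (f (_, _)); rewrite mulg1.
by case/f_inj.
Qed.

Theorem theorem3 (G : groupType) :
  same_edges (power_graph G) (commuting_graph G) <->
  [/\ ~ has_subgroup_isomorphic_to G infinite_cyclic,
      ~ has_subgroup_isomorphic_to G (infinite_cyclic * infinite_cyclic)%type,
      forall p : nat, prime p ->
        ~ has_subgroup_isomorphic_to G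
            (infinite_cyclic * cyclic_of_order p)%type
    & forall p q : nat, prime p -> prime q ->
        ~ has_subgroup_isomorphic_to G
            (cyclic_of_order p * cyclic_of_order q)%type].
Proof.
split=> [eq_edges | [noZ _ _ noCpCq]].
  have noZ : ~ has_subgroup_isomorphic_to G infinite_cyclic.
    move/(commuting_subgroup_power eq_edges)/(_ (Posz 2) (Posz 3)).
    case; first exact: Algebra.commuteT.
      by case=> m; rewrite zexpg_infinite_cyclic; lia.
    by case=> m; rewrite zexpg_infinite_cyclic; lia.
  split=> // [/has_subgroup_isomorphic_to_fst // | p _ | p q p_pr q_pr].
    by move/has_subgroup_isomorphic_to_fst.
  (* Valid for every [n], as ['Z_n] always has at least two elements. *)
  have one_neq n : (1%R : 'Z_n) <> 0%R by [].
  set A := cyclic_of_order p; set B := cyclic_of_order q.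
  pose a : A * B := ((1%R : 'Z_p), (0%R : 'Z_q)).
  pose b : A * B := ((0%R : 'Z_p), (1%R : 'Z_q)).
  have fstM : {morph (@fst A B) : x y / x * y} by [].
  have sndM : {morph (@snd A B) : x y / x * y} by [].
  move/(commuting_subgroup_power eq_edges)/(_ a b).
  case; first by congr (_, _); apply: Algebra.commuteT.
    (* In the first coordinate [b] is neutral, hence so are its powers, while [a] is not; the second
       coordinate is symmetric. *)
    case=> m /(congr1 fst); rewrite (zexpg_morph _ _ fstM) zexpg1n.
    exact: one_neq.
  case=> m /(congr1 snd); rewrite (zexpg_morph _ _ sndM) zexpg1n.
  exact: one_neq.
have torsion (x : G) : exists2 n, 0 < n & x ^+ n = 1.
  apply: contrapT => x_inf; apply/noZ/(has_infinite_cyclic (x := x)).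
  by move=> n n_gt0 xn; apply: x_inf; exists n.
have unique_prime_subgroup (u v : G) p q : prime p -> prime q -> commute u v ->
    u <> 1 -> u ^+ p = 1 -> v ^+ q = 1 -> exists k, v = u ^+ k.
  move=> p_pr q_pr cuv u_n1 up vq; apply: contrapT => v_nu.
  exact: (noCpCq p q p_pr q_pr) (has_CpCq p_pr q_pr cuv u_n1 up vq v_nu).
have zpow (x y : G) : (exists k, x = y ^+ k) -> is_power_of x y.
  by case=> k ->; exists (Posz k).
move=> x y; split=> -[neq_xy] => [pow_xy | cxy]; split=> //.
  (* An element commutes with its powers in any group, so this inclusion is unconditional. *)
  by case: pow_xy => -[m ->]; [apply/commute_sym |]; exact: commute_zexpg.
have [/zpow|/zpow] := commuting_torsion_power unique_prime_subgroup cxy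
  (torsion x) (torsion y); by [left | right].
Qed.
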